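(* Let $m \geq 2$ be an integer such that $m \equiv 2, 3, 5$ or $6 \pmod 9$, or $m < 448$. Then no concatenation of a cyclic permutation of $1, 2, \ldots, m$ is a perfect power; that is, for every $i \in \{1, \ldots, m\}$, the positive integer whose decimal representation is the concatenation, in this order, of the decimal representations of $i, i+1, \ldots, m, 1, 2, \ldots, i-1$ is not of the form $a^k$ with $a$ a positive integer and $k \geq 2$ an integer.
   Context: For a positive integer $m$, $A007908(m)$ is the positive integer whose decimal representation is the concatenation of the decimal representations of $1, 2, \ldots, m$ in this order. The cyclic permutations of $A007908(m)$ permute the whole numbers $1, \ldots, m$ cyclically, not individual digits (e.g. for $m=3$ they give $123, 231, 312$); these integers, over all $m \geq 1$, are the terms of the sequence $A001292$. Kashihara's conjecture states that no term of $A001292$ other than the trivial term $1$ is a perfect power. A positive integer $d$ is a perfect power if $d = a^k$ for some positive integer $a$ and some integer $k \geq 2$. *)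

(* Defs.v *)
(* Standard library only: natural numbers and the decimal numerals
   [Decimal.uint] of the prelude. *)
From Stdlib Require Import List Arith.

(* The terms i, i+1, ..., m, 1, 2, ..., i-1 (the second argument of [seq] is a
   length), meaningful for 1 <= i <= m. *)
Definition cyclic_perm (m i : nat) : list nat :=
  seq i (m + 1 - i) ++ seq 1 (i - 1).

(* [Decimal.uint] lists the digits with the most significant one first, and
   [Nat.to_uint] produces no leading zero. *)
Definition decimal_concat (l : list nat) : nat :=
  Nat.of_uint (fold_right Decimal.app Decimal.Nil (map Nat.to_uint l)).

Definition perfect_power (d : nat) : Prop :=
  exists a k : nat, 1 <= a /\ 2 <= k /\ d = a ^ k.

(* Main.v *)
(* Write [N] for the concatenation. Its digit sum gives [2 N = m (m + 1)] mod 9,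
   so in the four residue classes 3 divides [N] exactly once.

   For [m < 448], let [P] and [P_i] be the concatenations of [1 .. m] and of
   [1 .. i-1], with [L] and [L_i] digits. Then
   [N = P * 10^L_i - (10^L - 1) * P_i], so the residue of [N] modulo any small
   number comes from two tables indexed by [m] and [i]. If a prime [q < 100]
   divides [N], an exponent [k] with [N = a^k] is at most the multiplicity of
   [q] in [N]; otherwise [a > 100], hence [2 k < L]. The remaining exponents are
   excluded by exhibiting, for a divisor [k'] of [k], a prime [p] congruent to 1
   mod [k'] modulo which [N] is not a [k']-th power. *)

Require Import Defs.
From Stdlib Require Import List Arith NArith Lia DecimalNat.
From mathcomp Require ssreflect ssrfun ssrbool eqtype ssrnat div prime binomial.
Import ListNotations.

(** * Decimal concatenations *)

(** [Decimal.app] reverses its first argument and then applies [revapp], so the induction is on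
    [revapp] with an arbitrary accumulator; [of_lu] reads the reversed digits, least significant
    first. *)
Lemma of_uint_acc_revapp a b n :
  Nat.of_uint_acc (Decimal.revapp a b) n =
  Nat.of_uint_acc b (Unsigned.of_lu a + n * 10 ^ Unsigned.usize a).
Proof.
  revert b n; induction a; intros b n; cbn [Decimal.revapp];
    [f_equal; cbn; lia | rewrite IHa; cbn [Nat.of_uint_acc Unsigned.of_lu];
     f_equal; rewrite Nat.tail_mul_spec; cbn [Unsigned.usize Nat.pow]; lia ..].
Qed.

Lemma usize_revapp a b :
  Unsigned.usize (Decimal.revapp a b) = Unsigned.usize a + Unsigned.usize b.
Proof. revert b; induction a; intros b; cbn; trivial; rewrite IHa; cbn; lia. Qed.

Lemma of_lu_lt d : Unsigned.of_lu d < 10 ^ Unsigned.usize d.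
Proof. induction d; cbn [Unsigned.of_lu Unsigned.usize Nat.pow]; lia. Qed.

Lemma of_uint_app d e :
  Nat.of_uint (Decimal.app d e) =
  Nat.of_uint d * 10 ^ Unsigned.usize e + Nat.of_uint e.
Proof.
  unfold Decimal.app, Nat.of_uint at 1.
  rewrite of_uint_acc_revapp, Unsigned.of_uint_acc_spec, !Unsigned.of_uint_alt; lia.
Qed.

Lemma usize_app d e :
  Unsigned.usize (Decimal.app d e) = Unsigned.usize d + Unsigned.usize e.
Proof.
  unfold Decimal.app, Decimal.rev; rewrite !usize_revapp; cbn; lia.
Qed.

Lemma of_uint_lt d : Nat.of_uint d < 10 ^ Unsigned.usize d.
Proof.
  rewrite Unsigned.of_uint_alt.
  replace (Unsigned.usize d) with (Unsigned.usize (Decimal.rev d));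
    [apply of_lu_lt | unfold Decimal.rev; rewrite usize_revapp; cbn; lia].
Qed.

Definition width (n : nat) : nat := Unsigned.usize (Nat.to_uint n).

Definition digits (l : list nat) : nat := list_sum (map width l).

Lemma digits_app l1 l2 : digits (l1 ++ l2) = digits l1 + digits l2.
Proof. unfold digits; rewrite map_app; apply list_sum_app. Qed.

Lemma usize_concat l :
  Unsigned.usize (fold_right Decimal.app Decimal.Nil (map Nat.to_uint l)) = digits l.
Proof.
  induction l as [|x l IH]; [reflexivity | cbn [map fold_right]].
  rewrite usize_app, IH; reflexivity.
Qed.

Lemma decimal_concat_lt l : decimal_concat l < 10 ^ digits l.
Proof. rewrite <- usize_concat; apply of_uint_lt. Qed.

Lemma decimal_concat_cons x l :
  decimal_concat (x :: l) = x * 10 ^ digits l + decimal_concat l.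
Proof.
  unfold decimal_concat at 1; cbn [map fold_right].
  rewrite of_uint_app, Unsigned.of_to, usize_concat; reflexivity.
Qed.

Lemma decimal_concat_app l1 l2 :
  decimal_concat (l1 ++ l2) =
  decimal_concat l1 * 10 ^ digits l2 + decimal_concat l2.
Proof.
  induction l1 as [|x l1 IH]; [reflexivity | cbn [app]].
  rewrite !decimal_concat_cons, IH, digits_app, Nat.pow_add_r; lia.
Qed.

(** These are L_i and P_i; L and P are their values at m + 1. *)
Definition digits_below (i : nat) : nat := digits (seq 1 (i - 1)).
Definition concat_below (i : nat) : nat := decimal_concat (seq 1 (i - 1)).

Lemma seq_below_S i : 1 <= i -> seq 1 (S i - 1) = seq 1 (i - 1) ++ [i].
Proof.
  intros Hi; replace (S i - 1) with (S (i - 1)) by lia.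
  rewrite seq_S; do 2 f_equal; lia.
Qed.

Lemma digits_below_S i : 1 <= i -> digits_below (S i) = digits_below i + width i.
Proof.
  intros Hi; unfold digits_below; rewrite seq_below_S, digits_app by assumption; cbn; lia.
Qed.

Lemma concat_below_S i : 1 <= i -> concat_below (S i) = concat_below i * 10 ^ width i + i.
Proof.
  intros Hi; unfold concat_below; rewrite seq_below_S, decimal_concat_app by assumption.
  rewrite decimal_concat_cons; unfold digits; cbn [map list_sum fold_right].
  rewrite Nat.add_0_r; cbn; lia.
Qed.

Lemma seq_cut m i : 1 <= i <= m ->
  seq 1 (S m - 1) = seq 1 (i - 1) ++ seq i (m + 1 - i).
Proof.
  intros Hi; replace (S m - 1) with ((i - 1) + (m + 1 - i)) by lia.
  rewrite seq_app; do 2 f_equal; lia.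
Qed.

Lemma digits_cyclic_perm m i : 1 <= i <= m ->
  digits (cyclic_perm m i) = digits_below (S m).
Proof.
  intros Hi; unfold digits_below, cyclic_perm; rewrite (seq_cut m i Hi), !digits_app; lia.
Qed.

(* Cutting [1, ..., m] before [i] gives [concat_below (m+1) = concat_below i * 10^d + x],
   and the rotation is [x * 10^(digits_below i) + concat_below i]. *)
Lemma decimal_concat_cyclic_perm m i : 1 <= i <= m ->
  decimal_concat (cyclic_perm m i) + concat_below i * 10 ^ digits_below (S m) =
  concat_below (S m) * 10 ^ digits_below i + concat_below i.
Proof.
  intros Hi; unfold digits_below at 1, concat_below at 2.
  rewrite (seq_cut m i Hi), digits_app, decimal_concat_app, Nat.pow_add_r.
  unfold cyclic_perm; rewrite decimal_concat_app.
  fold (digits_below i) (concat_below i); lia.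
Qed.


(** Every power of ten is 1 mod 9. The natural witness [c] also makes the concatenation at least the
    sum of its terms, which later shows that it exceeds 1. *)
Lemma decimal_concat_mod9 l :
  exists c, decimal_concat l = list_sum l + 9 * c.
Proof.
  induction l as [|x l [c IH]]; [exists 0; reflexivity|].
  assert (H10 : exists t, 10 ^ digits l = 1 + 9 * t).
  { induction (digits l) as [|n [t Ht]]; [exists 0; reflexivity|].
    exists (1 + 10 * t); cbn [Nat.pow]; rewrite Ht; lia. }
  destruct H10 as [t Ht]; exists (x * t + c).
  rewrite decimal_concat_cons, Ht, IH; cbn [list_sum fold_right]; fold (list_sum l); lia.
Qed.

Lemma sum_cyclic_perm m i : 1 <= i <= m ->
  2 * list_sum (cyclic_perm m i) = m * (m + 1).
Proof.
  intros Hi; unfold cyclic_perm; rewrite list_sum_app, Nat.add_comm, <- list_sum_app.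
  rewrite <- (seq_cut m i Hi); replace (S m - 1) with m by lia.
  clear Hi i; induction m as [|m IH]; [reflexivity|].
  rewrite seq_S, list_sum_app, Nat.mul_add_distr_l, IH; cbn; lia.
Qed.

Lemma decimal_concat_cyclic_perm_gt1 m i : 2 <= m -> 1 <= i <= m ->
  1 < decimal_concat (cyclic_perm m i).
Proof.
  intros Hm Hi; destruct (decimal_concat_mod9 (cyclic_perm m i)) as [c Hc].
  pose proof (sum_cyclic_perm m i Hi); nia.
Qed.

(** * A certificate checker for lengths below 448 *)

Section Checker.
Local Open Scope N_scope.

(* All primes [q] below 100, each with an exponent [e] exceeding the multiplicities
   of [q] that occur, so that they are visible modulo [q ^ e]. *)
Definition small_primes : list (N * N) :=
  [(2, 15); (3, 11); (5, 5); (7, 5); (11, 6); (13, 4); (17, 4); (19, 4);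
   (23, 3); (29, 3); (31, 3); (37, 3); (41, 3); (43, 3); (47, 3); (53, 3);
   (59, 3); (61, 3); (67, 3); (71, 2); (73, 2); (79, 2); (83, 2); (89, 3);
   (97, 2)].

(* An entry [(k, l)] lists pairs [(p, h)] with [p] a prime congruent to 1 mod [k]
   and [h] a generator of the group of nonzero [k]-th powers mod [p]. *)
Definition power_moduli : list (N * list (N * N)) :=
  [(2, [(3, 1); (5, 4); (7, 4); (11, 4); (13, 4); (17, 9); (19, 4); (23, 4);
   (29, 4); (31, 9); (37, 4); (41, 36); (43, 9); (47, 4); (53, 4); (59, 4)]);
   (3, [(7, 6); (13, 8); (19, 8); (31, 27); (37, 8); (43, 8); (61, 8); (67,
   8); (73, 52); (79, 27); (97, 28); (103, 27); (109, 107)]);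
   (5, [(11, 10); (31, 26); (41, 38); (61, 32); (71, 51); (101, 32); (131,
   32)]);
   (7, [(29, 12); (43, 37); (71, 14); (113, 40); (127, 28)]);
   (11, [(23, 22); (67, 38); (89, 37); (199, 37)]);
   (13, [(53, 30); (79, 24); (131, 70); (157, 22); (313, 43)]);
   (17, [(103, 57); (137, 127); (239, 195); (307, 139)]);
   (19, [(191, 82); (229, 140); (419, 119); (457, 240)]);
   (23, [(47, 46); (139, 97); (277, 35); (461, 252)]);
   (29, [(59, 58); (233, 221); (349, 24)]);
   (31, [(311, 305); (373, 304); (683, 512)]);
   (37, [(149, 105); (223, 184); (593, 384)]);
   (41, [(83, 82); (739, 542); (821, 481)]);
   (43, [(173, 80); (431, 315); (947, 367); (1033, 135)]);
   (47, [(283, 239); (659, 515); (941, 66)]);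
   (53, [(107, 106); (743, 632); (1061, 682)]);
   (59, [(709, 187); (827, 337); (1063, 201)]);
   (61, [(367, 284); (733, 493); (977, 620)]);
   (67, [(269, 187); (1609, 610); (1877, 1100)]);
   (71, [(569, 277); (853, 235); (1279, 994)]);
   (73, [(293, 138); (439, 268); (877, 637)]);
   (79, [(317, 203); (1423, 1126); (2213, 572)]);
   (83, [(167, 166); (499, 140); (997, 906)]);
   (89, [(179, 178); (1069, 1035)]); (97, [(389, 115); (971, 906)]);
   (101, [(607, 211); (809, 239); (1213, 542)]);
   (103, [(619, 367); (1031, 513)]);
   (107, [(643, 466); (857, 669); (1499, 185)]);
   (109, [(1091, 801); (2399, 969); (2617, 1961)]);
   (113, [(227, 226); (1583, 1309)]); (127, [(509, 301); (2287, 129)]);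
   (131, [(263, 262); (787, 380)]); (137, [(823, 649); (1097, 486)]);
   (139, [(557, 118); (1669, 1152); (2503, 223)]);
   (149, [(1193, 524); (1789, 919)]);
   (151, [(907, 385); (1511, 743); (2417, 1443)]);
   (157, [(1571, 950); (3769, 2146)]);
   (163, [(653, 149); (2609, 1866); (5869, 5229)]);
   (167, [(2339, 190); (5011, 3138)]); (173, [(347, 346); (1039, 141)]);
   (179, [(359, 358); (1433, 1091)]); (181, [(1087, 830); (1811, 619)]);
   (191, [(383, 382); (2293, 2180); (3821, 2084)]);
   (193, [(773, 317); (1931, 467)]); (197, [(3547, 1468); (4729, 932)]);
   (199, [(797, 215); (2389, 467); (3583, 1595)]);
   (211, [(2111, 2036); (4643, 4055)]); (223, [(2677, 1501); (6691, 4746)]);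
   (227, [(5449, 1518); (5903, 3739)]); (229, [(2749, 671); (5039, 909)]);
   (233, [(467, 466); (1399, 1009)]); (239, [(479, 478); (1913, 922)]);
   (241, [(1447, 705); (2411, 371)]); (251, [(503, 502); (4519, 2101)]);
   (257, [(1543, 862); (9767, 9344); (13879, 2059)]);
   (263, [(1579, 640); (5261, 5129)]); (269, [(2153, 246); (3229, 1573)]);
   (271, [(1627, 1363); (2711, 2301)]); (277, [(1109, 354); (1663, 319)]);
   (281, [(563, 562); (3373, 1420)]); (283, [(1699, 398); (6793, 3920)]);
   (293, [(587, 586); (1759, 1251)]); (307, [(1229, 632); (5527, 3871)]);
   (311, [(1867, 835); (3733, 3313)]); (313, [(1879, 1391); (5009, 4116)]);
   (317, [(8243, 6543); (9511, 4887)]); (331, [(1987, 648); (5297, 3253)]);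
   (337, [(3371, 1175); (5393, 1476)]); (347, [(2083, 450); (2777, 2553)]);
   (349, [(3491, 2968); (8377, 2077)]); (353, [(4943, 4531); (14827, 7619)]);
   (359, [(719, 718); (10771, 240)]); (367, [(2203, 286); (3671, 2675)]);
   (373, [(1493, 432); (2239, 296)]); (379, [(4549, 273); (6823, 3191)]);
   (383, [(4597, 1842); (11491, 7730)]);
   (389, [(9337, 2439); (14783, 12793)]); (397, [(2383, 1280); (6353,
   6192)]);
   (401, [(3209, 22); (4813, 3668)]); (409, [(1637, 316); (4091, 3450)]);
   (419, [(839, 838); (5867, 1738)]); (421, [(4211, 3339); (6737, 4715)]);
   (431, [(863, 862); (3449, 953)]); (433, [(1733, 1323); (5197, 2715)]);
   (439, [(4391, 372); (13171, 6675)]); (443, [(887, 886); (2659, 904)]);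
   (449, [(3593, 1439); (6287, 279)]); (457, [(13711, 11525); (16453,
   9592)]);
   (461, [(2767, 329); (9221, 5784)]); (463, [(5557, 1649); (11113, 4462)]);
   (467, [(2803, 2390); (9341, 2320)]); (479, [(3833, 19); (5749, 3417)]);
   (487, [(1949, 589); (4871, 4005)]); (491, [(983, 982); (3929, 2286)]);
   (499, [(1997, 1585); (10979, 722)]); (503, [(3019, 240); (6037, 232)]);
   (509, [(1019, 1018); (4073, 1149)]); (521, [(16673, 4368); (18757,
   6112)]);
   (523, [(5231, 4924); (6277, 1096)]); (541, [(9739, 6320); (11903, 4420)]);
   (547, [(5471, 1868)]); (557, [(3343, 1919); (4457, 4037)]);
   (563, [(7883, 2685); (11261, 6279)]); (569, [(6829, 3124); (10243,
   2189)]);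
   (571, [(5711, 4309)]); (577, [(2309, 1621)]);
   (587, [(8219, 2006); (10567, 1323)]); (593, [(1187, 1186); (3559, 2124)]);
   (599, [(4793, 3420)]); (601, [(3607, 1400); (6011, 672)]);
   (607, [(3643, 423); (18211, 4627)]); (613, [(6131, 5472)])].

(* In row [i] of the tables, [shift] is [10 ^ L_i] and [below] is [P_i], both
   reduced; row [m + 1] plays the role of the upper end of the rotation. *)
Record cell := Cell
  { modulus : N; power_residues : list N; shift : N; below : N }.

Definition next_cell (b i : N) (c : cell) : cell :=
  Cell (modulus c) (power_residues c)
    ((shift c * b) mod modulus c) ((below c * b + i) mod modulus c).

(** Here [x] comes from row i and [y] from row m + 1. The factor in parentheses represents 1 - 10^L;
    it is not truncated, as [shift y] is reduced. *)
Definition residue (x y : cell) : N :=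
  (below y * shift x + (N.succ (modulus y) - shift y) * below x) mod modulus y.

(** Each prime q has a cell modulo q, for the divisibility test, and one modulo q^e, consulted only
    when q divides. *)
Definition sieve_row := list (N * N * (cell * cell)).
Definition power_row := list (N * list cell).

Definition next_sieve_row (b i : N) : sieve_row -> sieve_row :=
  map (fun d => (fst d, (next_cell b i (fst (snd d)), next_cell b i (snd (snd d))))).
Definition next_power_row (b i : N) : power_row -> power_row :=
  map (fun d => (fst d, map (next_cell b i) (snd d))).

(** In the state of index m + 1, [relevant] concerns the length m, and [total] is L. *)
Record state := State
  { index : N; relevant : bool; total : N;
    sieve_cells : sieve_row; power_cells : power_row }.

Definition relevant_length (m : N) : bool :=
  (2 <=? m) && match m mod 9 with 2 | 3 | 5 | 6 => false | _ => true end.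

Definition numeral_width (i : N) : N :=
  if i <? 10 then 1 else if i <? 100 then 2 else 3.

Definition next_state (s : state) : state :=
  let i := index s in
  let w := numeral_width i in
  let b := 10 ^ w in
  State (N.succ i) (relevant_length i) (total s + w)
    (next_sieve_row b i (sieve_cells s)) (next_power_row b i (power_cells s)).

Fixpoint states (n : nat) (s : state) : list state :=
  match n with O => [] | S n => s :: states n (next_state s) end.

Fixpoint powers_mod (n : nat) (h p x : N) : list N :=
  match n with O => [] | S n => x :: powers_mod n h p ((x * h) mod p) end.

(** As p is 1 mod k, the quotient p / k is (p - 1) / k, the number of nonzero k-th powers. *)
Definition unit_powers (k : N) (d : N * N) : list N :=
  powers_mod (N.to_nat (fst d / k)) (snd d) (fst d) 1.

Definition first_cell (p : N) (l : list N) : cell := Cell p l (1 mod p) (0 mod p).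

Definition first_state : state :=
  State 1 false 0
    (map (fun d => (d, (first_cell (fst d) [], first_cell (fst d ^ snd d) [])))
      small_primes)
    (map (fun d => (fst d,
        map (fun e => first_cell (fst e) (0 :: unit_powers (fst d) e)) (snd d)))
      power_moduli).

Fixpoint valuation (e : nat) (q r : N) : nat :=
  match e with
  | O => O
  | S e => if r mod q =? 0 then S (valuation e q (r / q)) else O
  end.

(** The number is known only modulo q^e, so a multiplicity counted there is reliable only below e;
    otherwise the test fails with [None]. *)
Fixpoint exponent_bound (K : N) (xs ys : sieve_row) : option N :=
  match xs, ys with
  | (q, e, (x, X)) :: xs, (_, (y, Y)) :: ys =>
    if residue x y =? 0 then
      let v := N.of_nat (valuation (N.to_nat e) q (residue X Y)) in
      if v <? e then Some v else None
    else exponent_bound K xs ys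
  | _, _ => Some K
  end.

Definition occurs (r : N) (l : list N) : bool := existsb (N.eqb r) l.

(** Conditionals in place of boolean connectives, here and below, let call-by-value evaluation stop
    early. *)
Fixpoint some_nonresidue (xs ys : list cell) : bool :=
  match xs, ys with
  | x :: xs, y :: ys =>
    if occurs (residue x y) (power_residues y) then some_nonresidue xs ys else true
  | _, _ => false
  end.

Fixpoint no_power_upto (K : N) (xs ys : power_row) : bool :=
  match xs, ys with
  | (k, x) :: xs, (_, y) :: ys =>
    if K <? k then true
    else if some_nonresidue x y then no_power_upto K xs ys else false
  | _, _ => true
  end.

(* The concatenations have at most 1233 digits, whence the bound 617. *)
Definition check_pair (s t : state) : bool :=
  match exponent_bound (N.div2 (total t)) (sieve_cells s) (sieve_cells t) with
  | Some K =>
    if K <? 617 then no_power_upto K (power_cells s) (power_cells t) else false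
  | None => false
  end.

Fixpoint check_states (l : list state) : bool :=
  match l with
  | [] => true
  | s :: l =>
    if forallb (fun t => if relevant t then check_pair s t else true) l
    then check_states l else false
  end.

(* Coefficients, constant term first, of [c * f + X * f + carry]. *)
Fixpoint mul_linear (p c carry : N) (f : list N) : list N :=
  match f with
  | [] => [carry]
  | a :: f => ((c * a + carry) mod p) :: mul_linear p c a f
  end.

Definition roots_poly (p : N) (l : list N) : list N :=
  fold_right (fun h f => mul_linear p (p - h) 0 f) [1] l.

(* The prime [p] divides the polynomial
   [\prod_(h <- l) (X - h) - (X ^ n.+1 - 1)], so [l] contains every
   [n.+1]-st root of unity mod [p]. *)
Definition splits_unity (p : N) (n : nat) (l : list N) : bool :=
  if list_eq_dec N.eq_dec (roots_poly p l) ((p - 1) :: repeat 0 n ++ [1])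
  then true else false.

(** Factoring X^((p-1)/k) - 1 certifies that the powers of [h] exhaust the nonzero k-th powers; p /
    k - 1 is passed because [splits_unity] uses the exponent n.+1. *)
Definition power_modulus_ok (k : N) (d : N * N) : bool :=
  (fst d mod k =? 1)
  && forallb (fun h => h <? fst d) (unit_powers k d)
  && splits_unity (fst d) (N.to_nat (fst d / k - 1)) (unit_powers k d).

End Checker.

(** * Soundness of the checker *)

Module Soundness.
Import ssreflect ssrfun ssrbool eqtype ssrnat div prime binomial.

Lemma powE a k : Nat.pow a k = a ^ k.
Proof. by elim: k => //= k ->; rewrite expnS. Qed.

Lemma moduloE a b : Nat.modulo a b = a %% b.
Proof.
case: b => [|b]; first by rewrite modn0.
have lt_mod : Nat.modulo a b.+1 < b.+1 by apply/ltP; apply: Nat.mod_upper_bound.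
by rewrite {2}(Nat.div_mod_eq a b.+1) plusE multE mulnC modnMDl modn_small.
Qed.

Lemma to_nat_mod a b : N.to_nat (a mod b)%num = N.to_nat a %% N.to_nat b.
Proof. by rewrite N2Nat.inj_mod moduloE. Qed.

Lemma to_nat_pow a b : N.to_nat (a ^ b)%num = N.to_nat a ^ N.to_nat b.
Proof. by rewrite N2Nat.inj_pow powE. Qed.

Definition to_natE :=
  (N2Nat.inj_add, N2Nat.inj_mul, N2Nat.inj_sub, N2Nat.inj_succ, to_nat_mod,
   to_nat_pow, Nat2N.id, plusE, multE, minusE).

Lemma ltb_to_nat a b : (a <? b)%num = (N.to_nat a < N.to_nat b).
Proof.
apply/idP/idP => [/N.ltb_lt lt_ab|/ltP lt_ab]; last by apply/N.ltb_lt; lia.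
by apply/ltP; lia.
Qed.

Lemma eqb_to_nat a b : (a =? b)%num = (N.to_nat a == N.to_nat b).
Proof. by apply/N.eqb_spec/eqP => [->|/N2Nat.inj]. Qed.

(** The prime q divides a, so q^k divides a^k; k > v would make q^(v+1) divide it too. *)
Lemma exponent_le q v a k : prime q -> 0 < k ->
  q %| a ^ k -> ~~ (q ^ v.+1 %| a ^ k) -> k <= v.
Proof.
move=> q_pr k_gt0; rewrite Euclid_dvdX // k_gt0 andbT => q_a.
apply: contraR; rewrite -ltnNge => lt_vk.
exact: dvdn_trans (dvdn_exp2l q lt_vk) (dvdn_exp2r k q_a).
Qed.

(** * Closed form of the table rows *)

Definition cell_at (i : nat) (p : N) (l : list N) : cell :=
  Cell p l (N.of_nat (10 ^ digits_below i %% N.to_nat p))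
           (N.of_nat (concat_below i %% N.to_nat p)).

Definition sieve_row_at (i : nat) : list (N * N) -> sieve_row :=
  List.map (fun d => (d, (cell_at i d.1 nil, cell_at i (d.1 ^ d.2)%num nil))).

Definition power_row_at (i : nat) : list (N * list (N * N)) -> power_row :=
  List.map (fun d =>
    (d.1, List.map (fun e => cell_at i e.1 (0%num :: unit_powers d.1 e)) d.2)).

Definition state_at (i : nat) : state :=
  State (N.of_nat i) (relevant_length (N.of_nat i.-1)) (N.of_nat (digits_below i))
    (sieve_row_at i small_primes) (power_row_at i power_moduli).

Lemma numeral_widthE i : 0 < i < 448 ->
  N.to_nat (numeral_width (N.of_nat i)) = width i.
Proof.
case/andP=> /ltP i_gt0 /ltP i_lt.
have: forallb (fun i => Nat.eqb (N.to_nat (numeral_width (N.of_nat i))) (width i))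
  (List.seq 1 447) = true by vm_compute.
by rewrite forallb_forall => /(_ i); rewrite in_seq Nat.eqb_eq; apply; lia.
Qed.

Lemma next_cell_at i p l : 0 < i < 448 ->
  next_cell (10 ^ numeral_width (N.of_nat i))%num (N.of_nat i) (cell_at i p l)
  = cell_at i.+1 p l.
Proof.
move=> i_bd; have i_gt0 : (1 <= i)%coq_nat by case/andP: i_bd => /ltP.
congr Cell; apply: N2Nat.inj; rewrite /= !to_natE numeral_widthE //.
  by rewrite modnMml digits_below_S // plusE expnD.
by rewrite concat_below_S // powE -modnDml modnMml modnDml.
Qed.

Lemma next_state_at i : 0 < i < 448 -> next_state (state_at i) = state_at i.+1.
Proof.
move=> i_bd; have i_gt0 : (1 <= i)%coq_nat by case/andP: i_bd => /ltP.
rewrite /next_state /state_at; move: small_primes power_moduli => ps ms.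
congr State => /=; first by lia.
- by rewrite digits_below_S // -numeral_widthE //; lia.
- rewrite /next_sieve_row /sieve_row_at map_map; apply: map_ext => d /=.
  by rewrite !next_cell_at.
rewrite /next_power_row /power_row_at map_map; apply: map_ext => d /=.
by rewrite map_map; congr pair; apply: map_ext => e; rewrite next_cell_at.
Qed.

Lemma first_state_at : first_state = state_at 1.
Proof. by vm_compute. Qed.

(** Row 448 is the last one: it closes the rotations of length 447, so [next_state] matters only at
    indices below 448. *)
Lemma states_at n i : 0 < i -> i + n <= 449 ->
  states n (state_at i) = List.map state_at (List.seq i n).
Proof.
elim: n i => //= n IH i i_gt0 i_n; congr cons.
case: n => // n in IH i_n *.
by rewrite next_state_at ?IH // ?i_gt0 ?addSnnS //= -ltnS;
   apply: leq_trans i_n; rewrite !addnS !ltnS leq_addr.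
Qed.

Lemma residue_at i j p l l' x : 0 < N.to_nat p ->
  x + concat_below i * 10 ^ digits_below j =
    concat_below j * 10 ^ digits_below i + concat_below i ->
  N.to_nat (residue (cell_at i p l) (cell_at j p l')) = x %% N.to_nat p.
Proof.
move=> p_gt0 def_x; rewrite /residue /= !to_natE; move: (N.to_nat p) p_gt0 => {}p p_gt0.
set T := 10 ^ digits_below j in def_x *; set P := concat_below i in def_x *.
have unmod A B c : A %% p * (B %% p) + c * (P %% p) = A * B + c * P %[mod p].
  by rewrite -modnDm modnMm modnMmr modnDm.
(* Adding P * T to both sides removes the subtraction: the coefficient of P on the left becomes p +
   1, which is 1 mod p. *)
apply/eqP; rewrite -(modn_mod _ p) -(eqn_modDr (P * T)) def_x modnDml -modnDml.
rewrite unmod modnDml -addnA eqn_modDl -modnDmr -(modnMmr P T) modnDmr.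
rewrite (mulnC _ P) -mulnDr subnK; last by apply/leqW/ltnW; rewrite ltn_mod.
by rewrite mulnS -modnDmr modnMl addn0.
Qed.

Lemma valuationP e q r : 0 < N.to_nat q -> valuation e q r < e ->
  ~~ (N.to_nat q ^ (valuation e q r).+1 %| N.to_nat r).
Proof.
move=> q_gt0; elim: e r => //= e IH r.
rewrite eqb_to_nat to_nat_mod -/(dvdn _ _).
case: ifP => [q_r|q_r _]; last by rewrite expn1 q_r.
have def_r : N.to_nat r = N.to_nat q * N.to_nat (r / q)%num.
  rewrite {1}(N.div_mod' r q) !to_natE; move/eqP: q_r => /= ->; by rewrite addn0.
by rewrite ltnS => /IH; rewrite def_r (expnS _ _.+1) dvdn_pmul2l.
Qed.

Lemma exponent_boundP i j x K K' ds :
    x + concat_below i * 10 ^ digits_below j =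
      concat_below j * 10 ^ digits_below i + concat_below i ->
    (forall d, In d ds -> prime (N.to_nat d.1)) ->
    exponent_bound K (sieve_row_at i ds) (sieve_row_at j ds) = Some K' ->
  K' = K /\ (forall d, In d ds -> ~~ (N.to_nat d.1 %| x)) \/
  exists q, [/\ prime q, q %| x & ~~ (q ^ (N.to_nat K').+1 %| x)].
Proof.
move=> def_x; elim: ds => [|[q e] ds IH] ds_pr /=; first by case=> ->; left.
have q_pr : prime (N.to_nat q) by apply: (ds_pr (q, e)); left.
have q_gt0 := prime_gt0 q_pr.
rewrite eqb_to_nat (residue_at i j q _ _ x) // -/(dvdn _ _).
case: ifP => [q_x|q_x /(IH (fun d ds_d => ds_pr d (or_intror ds_d)))[[-> ds_x]|]]; last 2 first.
- by left; split=> // d [<-|/ds_x //]; rewrite q_x.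
- by right.
set r := residue _ _; set v := valuation _ _ _.
rewrite ltb_to_nat Nat2N.id; case: ifP => // lt_ve [<-]; right; exists (N.to_nat q).
split=> //; rewrite Nat2N.id; have := valuationP _ _ _ q_gt0 lt_ve.
rewrite (residue_at i j _ _ _ x) // to_nat_pow ?expn_gt0 ?q_gt0 //.
(* Reduction modulo q^e preserves divisibility by q^(v+1), because v < e. *)
by rewrite /dvdn modn_dvdm // dvdn_exp2l.
Qed.

(** Increasing keys justify the early stop of [no_power_upto]: past the first key above K, all keys
    exceed K. *)
Definition sorted_keys : list (N * list (N * N)) -> bool :=
  fix sorted l := match l with
  | nil => true
  | d :: l => forallb (fun d' => d.1 <? d'.1)%num l && sorted l
  end.

Lemma some_nonresidueP i j x (f : N * N -> list N) es :
    x + concat_below i * 10 ^ digits_below j =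
      concat_below j * 10 ^ digits_below i + concat_below i ->
    (forall e, In e es -> prime (N.to_nat e.1)) ->
    some_nonresidue (List.map (fun e => cell_at i e.1 (f e)) es)
                    (List.map (fun e => cell_at j e.1 (f e)) es) ->
  exists2 e, In e es & ~~ occurs (N.of_nat (x %% N.to_nat e.1)) (f e).
Proof.
move=> def_x; elim: es => //= e es IH es_pr.
have e_pr : prime (N.to_nat e.1) by apply: es_pr; left.
rewrite -[residue _ _]N2Nat.id (residue_at i j e.1 (f e) (f e) x) ?prime_gt0 //.
case: ifP => [_ nr_es|nr_e _]; last by exists e; [left | rewrite nr_e].
case: (IH (fun e' es_e' => es_pr e' (or_intror es_e')) nr_es) => e' es_e' nr_e'.
by exists e'; [right |].
Qed.

Lemma no_power_uptoP i j x K ds :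
    x + concat_below i * 10 ^ digits_below j =
      concat_below j * 10 ^ digits_below i + concat_below i ->
    (forall d e, In d ds -> In e d.2 -> prime (N.to_nat e.1)) ->
    sorted_keys ds ->
    no_power_upto K (power_row_at i ds) (power_row_at j ds) ->
  forall d, In d ds -> N.to_nat d.1 <= N.to_nat K ->
  exists2 e, In e d.2 &
    ~~ occurs (N.of_nat (x %% N.to_nat e.1)) (0%num :: unit_powers d.1 e).
Proof.
move=> def_x; elim: ds => //= d ds IH ds_pr /andP[/forallb_forall d_lt ds_lt].
rewrite ltb_to_nat; case: ifP => [lt_Kd _ d' ds_d'|_].
  rewrite leqNgt => /negP[]; case: ds_d' => [<- //|/d_lt].
  by rewrite ltb_to_nat; apply: ltn_trans.
case: ifP => // nr_d up_ds d' [<- _|ds_d'].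
  apply: some_nonresidueP nr_d => // e; apply: ds_pr; by left.
by apply: IH => // d'' e ds_d''; apply: ds_pr; right.
Qed.

(** * Roots of unity modulo a prime *)

Fixpoint eval (f : list N) (x : nat) : nat :=
  if f is a :: f then N.to_nat a + x * eval f x else 0.

Lemma eval_mul_linear p c carry f x :
  eval (mul_linear p c carry f) x =
    N.to_nat carry + (x + N.to_nat c) * eval f x %[mod N.to_nat p].
Proof.
elim: f carry => [|a f IH] carry /=; first by rewrite !muln0.
rewrite !to_natE modnDml -modnDmr -modnMmr IH modnMmr modnDmr; congr (_ %% _).
by rewrite -plusE -multE; ring.
Qed.

(** Modulo a prime, a product vanishes only if some factor x + (p - h) does; with h < p this says
    that h is the residue of x. *)
Lemma root_roots_poly p l x : prime (N.to_nat p) ->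
    forallb (fun h => h <? p)%num l ->
    N.to_nat p %| eval (roots_poly p l) x ->
  occurs (N.of_nat (x %% N.to_nat p)) l.
Proof.
move=> p_pr; elim: l => [|h l IH] /=; first by rewrite muln0 addn0 Euclid_dvd1.
case/andP; rewrite ltb_to_nat => lt_hp lt_lp.
rewrite /dvdn eval_mul_linear /= -/(dvdn _ _) Euclid_dvdM // => /orP[|/IH->//]; last first.
  by rewrite orbT.
rewrite !to_natE => p_x; rewrite eqb_to_nat Nat2N.id.
suff: x == N.to_nat h %[mod N.to_nat p] by rewrite (modn_small lt_hp) => ->.
rewrite -(eqn_modDr (N.to_nat p - N.to_nat h)) (subnKC (ltnW lt_hp)) modnn.
exact: p_x.
Qed.

Lemma eval_unity n x : eval (repeat 0%num n ++ [1%num]) x = x ^ n.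
Proof.
by elim: n => [|n IH] /=; rewrite ?muln0 // IH expnS.
Qed.

(** By Fermat, a nonzero b^k is a root of X^((p-1)/k) - 1, and the certificate splits this
    polynomial over the listed residues. A zero power is the head of the list. *)
Lemma occurs_power_residue k d b : prime (N.to_nat d.1) -> power_modulus_ok k d ->
  occurs (N.of_nat (b ^ N.to_nat k %% N.to_nat d.1)) (0%num :: unit_powers k d).
Proof.
case: d => p h /= p_pr; rewrite /power_modulus_ok /= => /andP[/andP[pk1 lt_p]].
rewrite /splits_unity; case: list_eq_dec => // split_p _.
have [p_b|p_b] := boolP (N.to_nat p %| b ^ N.to_nat k).
  by move: p_b; rewrite /dvdn => /eqP->.
apply/orP; right; apply: root_roots_poly => //.
have p_gt1 := prime_gt1 p_pr.
have [n def_n def_p] : exists2 n, N.to_nat (p / k - 1)%num = n &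
    N.to_nat p = (N.to_nat k * n.+1).+1.
  exists (N.to_nat (p / k - 1)%num) => //.
  have := N.div_mod' p k; move/N.eqb_spec: pk1 => ->; move: p_gt1 => /ltP.
  move: (p / k)%num => q p_gt1' def_p.
  have -> : (N.to_nat (q - 1)%num).+1 = N.to_nat q by case: q def_p => [|q]; lia.
  by rewrite -multE -N2Nat.inj_mul; lia.
rewrite split_p /= eval_unity def_n -expnS -expnM.
set z := b ^ _; have p_b1 : ~~ (N.to_nat p %| b).
  by apply: contra p_b; apply: dvdn_exp; case: (N.to_nat k) def_p p_gt1 => // ->.
have z_gt0 : 0 < z by rewrite expn_gt0; case: b p_b1 {p_b z}; rewrite ?dvdn0.
have /eqP := fermat_little b p_pr; rewrite {1}def_p expnS -/z.
rewrite eqn_mod_dvd ?leq_pmulr // -{2}[b]muln1 -mulnBr Euclid_dvdM // (negPf p_b1) /=.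
(* The constant coefficient p - 1 stands for -1: (p - 1) + z = p + (z - 1). *)
by rewrite to_natE addnBAC ?(ltnW p_gt1) // -addnBA // dvdn_addr.
Qed.

(** * Validity of the numerical tables *)

Lemma small_primes_prime d : In d small_primes -> prime (N.to_nat d.1).
Proof.
have /forallb_forall ok : forallb (fun d => prime (N.to_nat d.1)) small_primes.
  by vm_compute.
exact: ok.
Qed.

Lemma small_primes_dvd a : 1 < a <= 100 ->
  exists2 d, In d small_primes & N.to_nat d.1 %| a.
Proof.
case/andP=> /ltP a_gt1 /leP a_le.
have /forallb_forall ok : forallb (fun a =>
  existsb (fun d => N.to_nat d.1 %| a) small_primes) (List.seq 2 99) by vm_compute.
have /ok/existsb_exists[d [ds_d d_a]] : In a (List.seq 2 99) by apply/in_seq; lia.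
by exists d.
Qed.

Lemma power_moduli_ok d e : In d power_moduli -> In e d.2 ->
  prime (N.to_nat e.1) /\ power_modulus_ok d.1 e.
Proof.
have /forallb_forall ok : forallb (fun d => forallb (fun e =>
  prime (N.to_nat e.1) && power_modulus_ok d.1 e) d.2) power_moduli by vm_compute.
by move=> /ok/forallb_forall ok_d /ok_d/andP.
Qed.

Lemma power_moduli_sorted : sorted_keys power_moduli.
Proof. by vm_compute. Qed.

Lemma power_moduli_dvd k : 1 < k < 617 ->
  exists2 d, In d power_moduli & N.to_nat d.1 %| k.
Proof.
case/andP=> /ltP k_gt1 /ltP k_lt.
have /forallb_forall ok : forallb (fun k =>
  existsb (fun d => N.to_nat d.1 %| k) power_moduli) (List.seq 2 615) by vm_compute.
have /ok/existsb_exists[d [ds_d d_k]] : In k (List.seq 2 615) by apply/in_seq; lia.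
by exists d.
Qed.

(** * From the computation to the absence of powers *)

Lemma check_statesP s n i j :
    check_states (List.map state_at (List.seq s n)) ->
    s <= i -> i < j < s + n -> relevant (state_at j) ->
  check_pair (state_at i) (state_at j).
Proof.
elim: n s => [|n IH] s.
  by rewrite addn0 => _ si /andP[/(leq_ltn_trans si)/ltn_trans jP /jP]; rewrite ltnn.
cbn [check_states List.map List.seq]; case: ifP => // /forallb_forall ok_s ok_n.
rewrite leq_eqVlt => /predU1P[<-|si]; last by rewrite addnS -addSn; apply: IH.
case/andP=> /ltP sj /ltP; rewrite -plusE => js rel_j.
by have := ok_s (state_at j); rewrite rel_j; apply; apply: in_map; rewrite in_seq; lia.
Qed.

(** The whole finite verification, over all rotations of relevant lengths below 448, is this single
    evaluation. *)
Lemma all_states_ok : check_states (states 448 first_state).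
Proof. by vm_cast_no_check (erefl true). Qed.

Lemma check_pair_sound m i a k : 1 < m -> 0 < i <= m ->
    check_pair (state_at i) (state_at m.+1) -> 0 < a -> 1 < k ->
  decimal_concat (cyclic_perm m i) <> a ^ k.
Proof.
move=> m_gt1 i_m; have i_m' : (1 <= i)%coq_nat /\ (i <= m)%coq_nat.
  by case/andP: i_m => /leP ? /leP.
set x := decimal_concat _; move=> ok_im a_gt0 k_gt1 def_x.
have x_id : x + concat_below i * 10 ^ digits_below m.+1 =
    concat_below m.+1 * 10 ^ digits_below i + concat_below i.
  by have := decimal_concat_cyclic_perm m i i_m'; rewrite !powE.
have x_lt : x < 10 ^ digits_below m.+1.
  by have /ltP := decimal_concat_lt (cyclic_perm m i); rewrite digits_cyclic_perm // powE.
have x_gt1 : 1 < x by apply/ltP/decimal_concat_cyclic_perm_gt1 => //; apply/leP.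
have a_gt1 : 1 < a.
  by case: a a_gt0 def_x => [|[|a]] // _ def_x; move: x_gt1; rewrite def_x exp1n.
have k_gt0 := ltnW k_gt1.
move: ok_im; rewrite /check_pair.
case def_K: (exponent_bound _ _ _) => [K|] //; rewrite ltb_to_nat; case: ifP => // K_lt ok_K.
have k_K : k <= N.to_nat K.
  case: (exponent_boundP _ _ _ _ _ _ x_id small_primes_prime def_K); last first.
    by case=> q [q_pr]; rewrite def_x; apply: exponent_le.
  case=> -> x_small; rewrite N2Nat.inj_div2 Nat2N.id.
  (* Otherwise a prime below 100 would divide a, hence x. *)
  have a_gt : 100 < a.
    rewrite ltnNge; apply/negP => a_le.
    have [|d ds_d d_a] := small_primes_dvd a; first by rewrite a_gt1.
    by have := x_small d ds_d; rewrite def_x dvdn_exp.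
  (* Here 10^(2k) = 100^k <= a^k = x. *)
  have : 10 ^ (2 * k) < 10 ^ digits_below m.+1.
    by apply: leq_ltn_trans x_lt; rewrite expnM def_x leq_exp2r // ltnW.
  rewrite ltn_exp2l // -multE => /ltP lt_k; apply/leP.
  by rewrite Nat.div2_div; apply: Nat.div_le_lower_bound; lia.
have [|d ds_d d_k] := power_moduli_dvd k; first by rewrite k_gt1 (leq_ltn_trans k_K).
have [||e es_e] := no_power_uptoP _ _ _ _ _ x_id _ power_moduli_sorted ok_K d ds_d.
- by move=> d' e' ds_d' /(power_moduli_ok _ _ ds_d')[].
- exact: leq_trans (dvdn_leq k_gt0 d_k) k_K.
have [e_pr e_ok] := power_moduli_ok d e ds_d es_e.
(* With d dividing k, x is the d-th power of a^(k/d), so its residue must be listed. *)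
have := occurs_power_residue _ _ (a ^ (k %/ N.to_nat d.1)) e_pr e_ok.
by rewrite -expnM divnK // def_x => ->.
Qed.

Lemma no_power_below_448 m i a k :
    (2 <= m)%coq_nat -> (m < 448)%coq_nat -> relevant_length (N.of_nat m) ->
    (1 <= i)%coq_nat -> (i <= m)%coq_nat -> (1 <= a)%coq_nat -> (2 <= k)%coq_nat ->
  decimal_concat (cyclic_perm m i) <> Nat.pow a k.
Proof.
move=> /leP m_gt1 /ltP m_lt rel_m /leP i_gt0 /leP i_m /leP a_gt0 /leP k_gt1.
rewrite powE; apply: check_pair_sound => //; first by rewrite i_gt0.
have bd : i < m.+1 < 1 + 448 by rewrite ltnS i_m.
have ok : check_states (List.map state_at (List.seq 1 448)).
  by rewrite -(states_at 448 1 isT isT) -first_state_at; apply: all_states_ok.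
exact (check_statesP 1 448 i m.+1 ok i_gt0 bd rel_m).
Qed.

Lemma no_power_mod9 x a k : (2 <= k)%coq_nat ->
  Nat.modulo x 9 = 3 \/ Nat.modulo x 9 = 6 -> x <> Nat.pow a k.
Proof.
rewrite moduloE powE => /leP k_gt1 x_mod def_x.
suff : k <= 1 by rewrite leqNgt k_gt1.
apply: (@exponent_le 3 1 a) => //; first exact: ltnW; rewrite -def_x.
  by rewrite /dvdn -(@modn_dvdm 9) //; case: x_mod => ->.
by rewrite /dvdn; case: x_mod => ->.
Qed.

End Soundness.

(** * The four residue classes modulo 9 *)

Lemma concat_mod9 m i : 1 <= i <= m ->
  m mod 9 = 2 \/ m mod 9 = 3 \/ m mod 9 = 5 \/ m mod 9 = 6 ->
  decimal_concat (cyclic_perm m i) mod 9 = 3 \/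
  decimal_concat (cyclic_perm m i) mod 9 = 6.
Proof.
  intros Hi Hm; destruct (decimal_concat_mod9 (cyclic_perm m i)) as [c Hc].
  pose proof (sum_cyclic_perm m i Hi) as Hs.
  pose proof (Nat.div_mod_eq m 9) as Hd.
  set (x := decimal_concat (cyclic_perm m i)) in *.
  pose proof (Nat.div_mod_eq x 9); pose proof (Nat.mod_upper_bound x 9).
  (* Naming the square of q makes the expansion of m (m + 1), for m = 9 q + r, linear once r is a
     numeral. *)
  set (q := m / 9) in *; set (p := q * q).
  assert (m * (m + 1) = 81 * p + 9 * (2 * (m mod 9) + 1) * q + m mod 9 * (m mod 9 + 1))
    by (rewrite Hd at 1 2; unfold p; ring).
  destruct Hm as [E|[E|[E|E]]]; rewrite E in *; lia.
Qed.

Lemma relevant_or_mod9 m : 2 <= m < 448 ->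
  relevant_length (N.of_nat m) = true \/
  m mod 9 = 2 \/ m mod 9 = 3 \/ m mod 9 = 5 \/ m mod 9 = 6.
Proof.
  intros Hm.
  assert (H : forallb (fun m => relevant_length (N.of_nat m) ||
    existsb (Nat.eqb (m mod 9)) [2; 3; 5; 6])%bool (seq 2 446) = true)
    by (vm_compute; reflexivity).
  rewrite forallb_forall in H; specialize (H m).
  rewrite in_seq, Bool.orb_true_iff, existsb_exists in H.
  destruct H as [H|(r & Hr & H)]; [lia | now left | right].
  apply Nat.eqb_eq in H; rewrite H; cbn in Hr; lia.
Qed.

Theorem corollary2p1 (m : nat) (hm : 2 <= m)
    (hcase : (m mod 9 = 2 \/ m mod 9 = 3 \/ m mod 9 = 5 \/ m mod 9 = 6)
             \/ m < 448)
    (i : nat) (hi : 1 <= i <= m) :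
  ~ perfect_power (decimal_concat (cyclic_perm m i)).
Proof.
  intros (a & k & Ha & Hk & Hx).
  assert (Hm : relevant_length (N.of_nat m) = true /\ m < 448 \/
    m mod 9 = 2 \/ m mod 9 = 3 \/ m mod 9 = 5 \/ m mod 9 = 6)
    by (destruct hcase as [|H]; [auto | destruct (relevant_or_mod9 m); auto]).
  destruct Hm as [[Hr Hm]|Hm].
  - now apply (Soundness.no_power_below_448 m i a k).
  - now apply (Soundness.no_power_mod9 _ a k Hk (concat_mod9 m i hi Hm)).
Qed.
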